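(* Let $h>0$ and $\lambda<0$. The general solution of the difference inequality $$y(t+h)-\lambda y(t)\le 0$$ is given by $$y(t)=|\lambda|^{t/h}\mu(t)+\sum_{s=1}^{\lfloor t\rfloor_h}\lambda^{s-1}q(t-sh),$$ where $q$ is any non-positive real-valued function and $\mu\in\mathbb{AP}_h$.
   Context: Functions are real-valued functions of a real variable. $\mathbb{AP}_h$ denotes the set of all functions $\mu:\mathbb{R}\to\mathbb{R}$ with $\mu(x+h)=-\mu(x)$ (antiperiodic functions with antiperiod $h$). For $h>0$, $\lfloor t\rfloor_h\in\mathbb{Z}$ is defined by $\lfloor t\rfloor_h=n$ where $t=nh+r$, $n\in\mathbb{Z}$, $0\le r<h$; equivalently $\lfloor t\rfloor_h=\lfloor t/h\rfloor$. A sum whose upper limit is smaller than its lower limit equals $0$.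
   Formalization: That every solution has the given form is stated only for t ≥ 0 (on all of R it fails: y = -1 is a solution not of this form, as the sum is empty for t < h); that every function of this form is a solution is stated for all real t. *)

(* Defs.v *)
From HB Require Import structures.
From mathcomp Require Import all_boot all_order all_algebra.
From mathcomp Require Import all_classical all_reals all_analysis.

Set Implicit Arguments.
Unset Strict Implicit.
Unset Printing Implicit Defensive.

Import Order.TTheory GRing.Theory Num.Theory.

Local Open Scope classical_set_scope.
Local Open Scope ring_scope.

Section Definitions.
Context {R : realType}.
Implicit Types (h lambda t : R) (y mu q : R -> R) (D : set R).

Definition antiperiodic h : set (R -> R) :=
  [set mu | forall x, mu (x + h) = - mu x].

Definition floor_step h t : int := Num.floor (t / h).

(* The upper limit is an integer; the sum is 0 when it is smaller than 1. *)
Definition sum_from1 (n : int) (F : nat -> R) : R :=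
  if n is Posz m then \sum_(1 <= s < m.+1) F s else 0.

Definition nonpositive q : Prop := forall x, q x <= 0.

(* The domain is explicit: since the sum in the general solution is empty for
   t < h, that formula satisfies the equation y (t + h) = lambda * y t at every
   t < 0, so it can capture all solutions only on the half-line t >= 0. *)
Definition solves_on D h lambda y : Prop :=
  forall t, D t -> y (t + h) - lambda * y t <= 0.

(* The exponent s - 1 is a natural number because s >= 1 in the sum. *)
Definition general_solution h lambda mu q t : R :=
  `|lambda| `^ (t / h) * mu t
  + sum_from1 (floor_step h t) (fun s => lambda ^+ s.-1 * q (t - s%:R * h)).

End Definitions.

(* Main.v *)
(* For a fixed forcing term q, the general solution satisfies
   y (t + h) = lambda * y t + q t at every t >= 0, and the homogeneous
   equation at every t < 0. Conversely, a solution y on t >= 0 is determined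
   by its values on [0, h[ and by q t := y (t + h) - lambda * y t; the values
   on [0, h[ can be prescribed freely through the antiperiodic function mu. *)

Require Import Defs.
From mathcomp Require Import all_boot all_order all_algebra.
From mathcomp Require Import all_classical all_reals all_analysis.
From mathcomp Require Import ring.

Set Implicit Arguments.
Unset Strict Implicit.
Unset Printing Implicit Defensive.

Import Order.TTheory GRing.Theory Num.Theory.

Local Open Scope classical_set_scope.
Local Open Scope ring_scope.

Section Recurrence.
Context {R : realType}.
Variables (h lambda : R).
Hypotheses (h_gt0 : 0 < h) (lambda_lt0 : lambda < 0).
Implicit Types (t : R) (y mu q : R -> R).

Lemma floor_stepDh t : floor_step h (t + h) = floor_step h t + 1.
Proof.
by rewrite /floor_step mulrDl divff ?gt_eqF// floorDrz ?floor1// rpred1.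
Qed.

Lemma floor_step_ge0 t : (0 <= floor_step h t) = (0 <= t).
Proof. by rewrite /floor_step floor_ge0 pmulr_lge0 ?invr_gt0. Qed.

Lemma floor_step_eq0 t : 0 <= t < h -> floor_step h t = 0.
Proof.
move=> /andP[t_ge0 t_lth]; apply: Num.Theory.floor_def.
by rewrite add0r divr_ge0 ?(ltW h_gt0)//= ltr_pdivrMr // mul1r.
Qed.

(** The shift contributes a factor [|lambda|] from the power and [-1] from [mu]; their product is
    [lambda] because [lambda < 0]. *)
Lemma powR_antiperiodicDh mu t : antiperiodic h mu ->
  `|lambda| `^ ((t + h) / h) * mu (t + h) =
  lambda * (`|lambda| `^ (t / h) * mu t).
Proof.
move=> mu_anti; rewrite mu_anti mulrDl divff ?gt_eqF// powRD; last first.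
  by apply/implyP => _; rewrite normr_eq0 lt_eqF.
rewrite powRr1// ltr0_norm//; ring.
Qed.

(** The shift adds one term to the sum: the new term [s = 1] is [q t], and the others, reindexed by
    one, are [lambda] times the old sum. *)
Lemma general_solutionDh mu q t : antiperiodic h mu -> 0 <= t ->
  general_solution h lambda mu q (t + h) =
  lambda * general_solution h lambda mu q t + q t.
Proof.
move=> mu_anti t_ge0.
rewrite /general_solution powR_antiperiodicDh// floor_stepDh mulrDr -addrA.
congr (_ + _); move: t_ge0; rewrite -floor_step_ge0.
case: (floor_step h t) => // n _.
rewrite -PoszD addn1 /= big_nat_recl//= expr0 mul1r mul1r addrK addrC.
congr (_ + _); rewrite big_distrr /= big_add1 /= [RHS]big_add1 /=.
apply: eq_bigr => s _.
rewrite /= exprS -mulrA; congr (_ * (_ * q _)).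
by rewrite -natr1; ring.
Qed.

Lemma general_solutionDh_lt0 mu q t : antiperiodic h mu -> t < 0 ->
  general_solution h lambda mu q (t + h) =
  lambda * general_solution h lambda mu q t.
Proof.
move=> mu_anti t_lt0.
rewrite /general_solution powR_antiperiodicDh// floor_stepDh mulrDr.
congr (_ + _); move: t_lt0; rewrite ltNge -floor_step_ge0.
(* Both sums are empty; in the borderline case of floor [-1] the shifted upper limit is [0], still
   below [1]. *)
case: (floor_step h t) => // -[|n] _; rewrite mulr0//=.
by rewrite big_geq.
Qed.

(** Induction on [floor_step h t]: as long as it is positive, [t - h] is nonnegative with floor one
    less, and the recurrences carry equality from [t - h] to [t]. *)
Lemma eq_recurrence (f g q : R -> R) :
  (forall t, 0 <= t -> f (t + h) = lambda * f t + q t) ->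
  (forall t, 0 <= t -> g (t + h) = lambda * g t + q t) ->
  (forall t, 0 <= t < h -> f t = g t) ->
  forall t, 0 <= t -> f t = g t.
Proof.
move=> fE gE fg t t_ge0.
have [n nE] : exists n : nat, floor_step h t = n.
  by move: t_ge0; rewrite -floor_step_ge0; case: floor_step => // n; exists n.
elim: n t t_ge0 nE => [|n IHn] t t_ge0 nE.
  apply: fg; rewrite t_ge0/= -[h]mul1r -ltr_pdivrMr//.
  by have := floorD1_gt (t / h); rewrite -/(floor_step h t) nE.
have tE : floor_step h (t - h) = n.
  by apply/(addIr 1); rewrite -floor_stepDh subrK nE -addn1 PoszD.
have th_ge0 : 0 <= t - h by rewrite -floor_step_ge0 tE.
by rewrite -[t](subrK h) fE// gE// IHn.
Qed.

(** For [h > 0], [f] is evaluated at the remainder of [t] modulo [h], with a sign alternating from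
    cell to cell; the integer power covers negative cells too. *)
Definition antiperiodic_extension (f : R -> R) t : R :=
  (-1) ^ floor_step h t * f (t - (floor_step h t)%:~R * h).

Lemma antiperiodic_extensionP f : antiperiodic h (antiperiodic_extension f).
Proof.
move=> t; rewrite /antiperiodic_extension floor_stepDh.
rewrite expfzDr ?oppr_eq0 ?oner_eq0// expr1z mulrN1 mulNr.
by congr (- (_ * f _)); rewrite intrD; ring.
Qed.

Lemma antiperiodic_extensionE f t :
  0 <= t < h -> antiperiodic_extension f t = f t.
Proof.
move=> /floor_step_eq0 tE.
by rewrite /antiperiodic_extension tE expr0z mul1r mul0r subr0.
Qed.

End Recurrence.

Theorem theorem3p4 (R : realType) (h lambda : R)
    (h_gt0 : 0 < h) (lambda_lt0 : lambda < 0) :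
  (forall y : R -> R,
     solves_on [set t | 0 <= t] h lambda y <->
     exists mu q : R -> R,
       [/\ antiperiodic h mu,
           nonpositive q &
           forall t : R, 0 <= t -> y t = general_solution h lambda mu q t]) /\
  (forall mu q : R -> R,
     antiperiodic h mu -> nonpositive q ->
     solves_on [set: R] h lambda (general_solution h lambda mu q)).
Proof.
have solvesP mu q : antiperiodic h mu -> nonpositive q ->
    solves_on [set: R] h lambda (general_solution h lambda mu q).
  move=> mu_anti q_le0 t _; have [t_ge0|t_lt0] := leP 0 t.
    by rewrite general_solutionDh// addrAC subrr add0r.
  by rewrite general_solutionDh_lt0// subrr.
split=> // y; split=> [ysol|[mu [q [mu_anti q_le0 yE]]] t /= t_ge0]; last first.
  by rewrite !yE ?addr_ge0 ?(ltW h_gt0)//; apply: solvesP.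
(* For [t < 0] nothing bounds the defect of [y], so the value [0] keeps [q] non-positive. *)
pose q t := if 0 <= t then y (t + h) - lambda * y t else 0.
(* On [[0, h[] the sum is empty, so dividing by the power makes the formula return [y] there. *)
pose mu := antiperiodic_extension h (fun r => y r / `|lambda| `^ (r / h)).
have mu_anti : antiperiodic h mu by exact: antiperiodic_extensionP.
exists mu, q; split=> //.
  by move=> t; rewrite /q; case: ifPn => // t_ge0; exact: ysol.
apply: (eq_recurrence h_gt0 (lambda := lambda) (q := q)) => t.
- by move=> t_ge0; rewrite /q t_ge0 [RHS]addrC subrK.
- exact: general_solutionDh.
move=> t_h; rewrite /general_solution floor_step_eq0//= big_geq// addr0.
rewrite /mu antiperiodic_extensionE// mulrCA divff ?mulr1//.
by rewrite gt_eqF// powR_gt0// normr_gt0 lt_eqF.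
Qed.
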